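(* Let $H_1,H_2$ be real Hilbert spaces, $C\subset H_1$ and $Q\subset H_2$ nonempty closed convex sets, $A:H_1\to H_2$ a bounded linear operator with adjoint $A^*$, and $f:C\times C\to\mathbb{R}$, $F:Q\times Q\to\mathbb{R}$ bifunctions. Let $\{\rho_n\},\{\beta_n\},\{\epsilon_n\},\{\mu_n\}$ ($n\ge 0$) be real sequences such that, for some constants $\rho>0$ and $a>0$: $\rho_n\ge\rho$, $\epsilon_n\ge 0$, $\beta_n>0$ and $a\le\mu_n\le \frac{1}{\|A\|^2}$ for all $n$; and $\sum_{n\ge1}\frac{\beta_n}{\rho_n}=+\infty$, $\sum_{n\ge1}\frac{\beta_n\epsilon_n}{\rho_n}<+\infty$, $\sum_{n\ge1}\beta_n^2<+\infty$. Assume that $f$ satisfies the following on $C$: (1) $f$ is pseudomonotone and $f(x,x)=0$ for all $x\in C$; (2) for each $x\in C$, $f(x,\cdot)$ is convex and lower semicontinuous on $C$, and for each $y\in C$, $f(\cdot,y)$ is weakly upper semicontinuous on $C$; (3) for every bounded $B\subset C$, the set $\bigcup_{n\ge 0}\bigcup_{x\in B}\partial_{\epsilon_n}f(x,\cdot)(x)$ is bounded; (4) if $x\in EP(f,C)$, $y\in C$ and $f(y,x)=0$, then $y\in EP(f,C)$. Assume that $F$ satisfies the same four conditions with $(F,Q)$ in place of $(f,C)$. Assume that the solution set $\Omega=\{x\in C:\ x\in EP(f,C),\ Ax\in EP(F,Q)\}$ is nonempty. Let $\{x_n\}$ be any sequence generated by the projection algorithm described in the context from an arbitrary starting point $x_0\in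 C$. Then the whole sequence $\{x_n\}$ converges weakly to some $x^\dagger\in\Omega$. Moreover, $x^\dagger=\lim_{n\to\infty}P_\Omega(x_n)$ (limit in norm).
   Context: For a nonempty closed convex subset $K$ of a Hilbert space, $P_K$ is the metric projection onto $K$. For $g:K\times K\to\mathbb{R}$, $EP(g,K)=\{x\in K: g(x,y)\ge 0\ \ \forall y\in K\}$. The bifunction $g$ is pseudomonotone on $K$ if for all $x,y\in K$, $g(x,y)\ge0$ implies $g(y,x)\le 0$. For $\epsilon\ge 0$, a function $\varphi:K\to\mathbb{R}$ and $x\in K$, $\partial_\epsilon\varphi(x)=\{w\in H:\ \varphi(y)-\varphi(x)+\epsilon\ge\langle w,y-x\rangle\ \ \forall y\in K\}$, where $H$ is the ambient Hilbert space; $\partial_\epsilon g(x,\cdot)(x)$ is the $\epsilon$-subdifferential of the function $g(x,\cdot)$ at the point $x$ (the $\epsilon$-diagonal subdifferential of $g$ at $x$). Projection algorithm. Choose $x_0\in C$. Given $x_n\in C$ ($n\ge0$): Step 1: set $u_n=P_Q(Ax_n)$, select any $w_n\in\partial_{\epsilon_n}F(u_n,\cdot)(u_n)$, and set $\gamma_n=\frac{\beta_n}{\max\{\rho_n,\|w_n\|\}}$, $y_n=P_Q(u_n-\gamma_n w_n)$. Step 2: set $z_n=P_C\big(x_n+\mu_nA^*(y_n-Ax_n)\big)$. Step 3: select any $g_n\in\partial_{\epsilon_n}f(z_n,\cdot)(z_n)$, and set $\alpha_n=\frac{\beta_n}{\max\{\rho_n,\|g_n\|\}}$, $x_{n+1}=P_C(z_n-\alpha_ng_n)$.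 Under the stated assumptions $\Omega$ is closed and convex, so $P_\Omega$ is well defined. *)

(* Defs.v *)
From HB Require Import structures.
From mathcomp Require Import all_boot all_order all_algebra.
From mathcomp Require Import all_classical all_reals all_analysis.

Set Implicit Arguments.
Unset Strict Implicit.
Unset Printing Implicit Defensive.

Import Order.TTheory GRing.Theory Num.Theory.
Import numFieldNormedType.Exports.

Local Open Scope classical_set_scope.
Local Open Scope ring_scope.

HB.mixin Record CompleteNormedModule_isHilbert (R : realType) V
    of CompleteNormedModule R V := {
  inner : {dot V for idfun} ;
  inner_norm : forall x : V, inner x x = `|x| ^+ 2
}.

#[short(type="hilbertType")]
HB.structure Definition Hilbert (R : realType) :=
  {V of CompleteNormedModule R V & CompleteNormedModule_isHilbert R V}.

Notation "''[' u , v ]" := (inner u v) : ring_scope.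

(* The coarsest topology on H making every functional '[_, v] continuous. *)
Definition weak (R : realType) (H : hilbertType R) : Type :=
  initial_topology (fun x : H => (fun v => '[x, v]) : {ptws H -> R^o}).

HB.instance Definition _ (R : realType) (H : hilbertType R) :=
  Topological.on (weak H).

Definition weak_cvg (R : realType) (H : hilbertType R) (x : nat -> H) (l : H) :=
  x @ \oo --> (l : weak H).

Lemma weak_cvgP (R : realType) (H : hilbertType R) (x : nat -> H) (l : H) :
  weak_cvg x l <->
  forall v : H, '[x n, v] @[n --> \oo] --> '[l, v].
Proof.
pose g := fun x : H => (fun v => '[x, v]) : {ptws H -> R^o}.
have gP : {ptws, g \o x @ \oo --> g l} <->
    forall v : H, '[x n, v] @[n --> \oo] --> '[l, v] by exact: pointwise_cvgP.
rewrite -gP; split => [xl U /(@initial_continuous H _ g l)|gxl U /=].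
  exact: xl.
move=> [_ /= [[B oB <-] /= Bgl]] /filterS; apply.
by apply: gxl; exact: open_nbhs_nbhs.
Qed.

Section HilbertNotions.
Context {R : realType}.

Definition opnorm (H1 H2 : hilbertType R) (A : H1 -> H2) : R :=
  sup [set `|A x| | x in [set x : H1 | `|x| <= 1]].

(* Total by choice; meaningful for bounded linear A, for which the Riesz
   theorem gives a unique z. *)
Definition adjoint (H1 H2 : hilbertType R) (A : H1 -> H2) (y : H2) : H1 :=
  xget 0 [set z | forall x : H1, '[A x, y] = '[x, z]].

(* Total by choice; meaningful for nonempty closed convex K, which has a unique
   point nearest to x. *)
Definition metric_proj (H : hilbertType R) (K : set H) (x : H) : H :=
  xget 0 [set p | K p /\ forall y, K y -> `|x - p| <= `|x - y|].

(* Semicontinuity of a real function on a subset of a topological space, that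
   is, for the relative topology of K. *)
Definition lsc_on (X : topologicalType) (K : set X) (g : X -> R) :=
  lower_semicontinuous ((fun x => (g x)%:E) : subspace K -> \bar R).

Definition usc_on (X : topologicalType) (K : set X) (g : X -> R) :=
  lsc_on K (fun x => - g x).

Definition weakly_usc_on (H : hilbertType R) (K : set H) (g : H -> R) :=
  @usc_on (weak H) K g.

End HilbertNotions.

(* Functions on K and bifunctions on K x K are total functions on H; only
   their values on K, resp. K x K, are ever constrained or used. *)
Section Equilibrium.
Context {R : realType} {H : hilbertType R}.
Implicit Types (K : set H) (g : H -> H -> R).

Definition EP g K : set H := [set x | K x /\ forall y, K y -> 0 <= g x y].

Definition pseudomonotone_on K g :=
  forall x y, K x -> K y -> 0 <= g x y -> g y x <= 0.

Definition subdiff (e : R) K (phi : H -> R) (x : H) : set H :=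
  [set w | forall y, K y -> '[w, y - x] <= phi y - phi x + e].

Record equilibrium_assumptions (eps : nat -> R) K g : Prop := {
  eqa_pseudomonotone : pseudomonotone_on K g ;
  eqa_diag : forall x, K x -> g x x = 0 ;
  eqa_convex : forall x, K x -> convex_function K (g x) ;
  eqa_lsc : forall x, K x -> lsc_on K (g x) ;
  eqa_weakly_usc : forall y, K y -> weakly_usc_on K (g ^~ y) ;
  eqa_bounded_subdiff : forall B : set H, B `<=` K -> bounded_set B ->
    bounded_set (\bigcup_n \bigcup_(x in B) subdiff (eps n) K (g x) x) ;
  eqa_closed_zero : forall x y, EP g K x -> K y -> g y x = 0 -> EP g K y
}.

End Equilibrium.

Section Algorithm.
Context {R : realType} {H1 H2 : hilbertType R}.

Definition solution_set (C : set H1) (Q : set H2) (A : H1 -> H2)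
    (f : H1 -> H1 -> R) (F : H2 -> H2 -> R) : set H1 :=
  [set x | C x /\ EP f C x /\ EP F Q (A x)].

Record projection_algorithm (C : set H1) (Q : set H2) (A : H1 -> H2)
    (f : H1 -> H1 -> R) (F : H2 -> H2 -> R) (rho beta eps mu : nat -> R)
    (x z g : nat -> H1) (u w y : nat -> H2) : Prop := {
  alg_init : C (x 0%N) ;
  alg_u : forall n, u n = metric_proj Q (A (x n)) ;
  alg_w : forall n, subdiff (eps n) Q (F (u n)) (u n) (w n) ;
  alg_y : forall n, let gamma := beta n / Num.max (rho n) `|w n| in
    y n = metric_proj Q (u n - gamma *: w n) ;
  alg_z : forall n, z n = metric_proj C (x n + mu n *: adjoint A (y n - A (x n))) ;
  alg_g : forall n, subdiff (eps n) C (f (z n)) (z n) (g n) ;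
  alg_x : forall n, let alpha := beta n / Num.max (rho n) `|g n| in
    x n.+1 = metric_proj C (z n - alpha *: g n)
}.

End Algorithm.

(* Main.v *)
Require Import Defs.
From HB Require Import structures.
From mathcomp Require Import all_boot all_order all_algebra.
From mathcomp Require Import all_classical all_reals all_analysis.
From mathcomp Require Import ring lra.

(** For p in Omega the iterates satisfy a quasi-Fejer inequality
    |x_{n+1} - p|^2 + a |u_n - A x_n|^2 + c tau_n G_n <= |x_n - p|^2 + eta_n
    with tau_n = beta_n / rho_n, eta summable and the gap
    G_n = - F (u_n, A p) - f (z_n, p) nonnegative by pseudomonotonicity.  Hence
    P_Omega x_n converges in norm to some xd, and any weak cluster point in
    Omega equals xd.  Cluster points along which G_n tends to 0 lie in Omega, by
    weak upper semicontinuity and assumption (4).  If q <> xd is a cluster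
    point, then phi_n = |x_n - xd|^2 - |x_n - q|^2 + |q - xd|^2 is frequently
    close to 2 |q - xd|^2.  Where phi_n >= |q - xd|^2 / 2 the gap is eventually
    bounded below, so the sum of tau_n over those n is finite; since phi
    decreases by at most O(tau_n) plus a summable term, it then stays above this
    threshold for all large n, and the sum of all tau_n is finite, a
    contradiction. *)

Set Implicit Arguments.
Unset Strict Implicit.
Unset Printing Implicit Defensive.

Import Order.TTheory GRing.Theory Num.Theory.
Import numFieldNormedType.Exports.

Local Open Scope classical_set_scope.
Local Open Scope ring_scope.

(** * Inner product identities, Cauchy-Schwarz, completeness *)

Section Inner.
Context {R : realType} {H : hilbertType R}.
Implicit Types (u v w : H) (a : R).

Lemma innerC u v : '[u, v] = '[v, u].
Proof. by rewrite hermC /= expr0 mul1r. Qed.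

Lemma innerDl u v w : '[u + v, w] = '[u, w] + '[v, w].
Proof. exact: linearDl. Qed.

Lemma innerDr u v w : '[u, v + w] = '[u, v] + '[u, w].
Proof. exact: linearDr. Qed.

Lemma innerNl u v : '[- u, v] = - '[u, v].
Proof. exact: linearNl. Qed.

Lemma innerNr u v : '[u, - v] = - '[u, v].
Proof. exact: linearNr. Qed.

Lemma innerZl a u v : '[a *: u, v] = a * '[u, v].
Proof. exact: linearZl_LR. Qed.

Lemma innerZr a u v : '[u, a *: v] = a * '[u, v].
Proof. by rewrite innerC innerZl innerC. Qed.

Lemma inner0l u : '[0, u] = 0.
Proof. exact: linear0l. Qed.

Lemma inner0r u : '[u, 0] = 0.
Proof. exact: linear0r. Qed.

Definition innerE := (innerDl, innerDr, innerNl, innerNr, innerZl, innerZr,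
  inner0l, inner0r).

Lemma sqr_normD u v : `|u + v| ^+ 2 = `|u| ^+ 2 + 2 * '[u, v] + `|v| ^+ 2.
Proof. by rewrite -!inner_norm !innerE (innerC v u); ring. Qed.

Lemma sqr_normB u v : `|u - v| ^+ 2 = `|u| ^+ 2 - 2 * '[u, v] + `|v| ^+ 2.
Proof. by rewrite sqr_normD innerNr normrN; ring. Qed.

(** Expand [0 <= | |v| u - |u| v |^2] and divide by [2 |u| |v|]; zero vectors are split off to allow
    the division. *)
Lemma inner_le_norm u v : '[u, v] <= `|u| * `|v|.
Proof.
have [->|u0] := eqVneq u 0; first by rewrite inner0l normr0 mul0r.
have [->|v0] := eqVneq v 0; first by rewrite inner0r normr0 mulr0.
have up : 0 < `|u| by rewrite normr_gt0.
have vp : 0 < `|v| by rewrite normr_gt0.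
have : 0 <= `| `|v| *: u - `|u| *: v| ^+ 2 by exact: sqr_ge0.
rewrite sqr_normB !normrZ !normr_id !innerE => h.
rewrite -(ler_pM2l (mulr_gt0 up vp)); lra.
Qed.

Lemma CauchySchwarz_inner u v : `|'[u, v]| <= `|u| * `|v|.
Proof.
rewrite ler_norml inner_le_norm andbT lerNl -innerNl.
by rewrite (le_trans (inner_le_norm _ _)) ?normrN.
Qed.

Lemma inner_continuousl v : continuous (fun u => '[u, v]).
Proof.
move=> u; apply/cvgrPdist_lt => e e0.
have p : 0 < `|v| + 1 by rewrite ltr_wpDl.
near=> t; rewrite -innerNl -innerDl.
apply: (le_lt_trans (CauchySchwarz_inner _ _)).
apply: (@le_lt_trans _ _ (`|u - t| * (`|v| + 1))).
  by rewrite ler_wpM2l// lerDl.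
rewrite -ltr_pdivlMr//.
near: t; apply: (@cvgr_dist_lt _ _ _ (nbhs u)); first exact: cvg_id.
exact: divr_gt0.
Unshelve. all: by end_near. Qed.

(** The criterion is in squared distances because the parallelogram identity and the projection
    inequality bound squares. *)
Lemma sqr_norm_cauchy_cvg (x : nat -> H) :
  (forall e, 0 < e -> exists N, forall n m, (N <= n)%N -> (N <= m)%N ->
    `|x n - x m| ^+ 2 <= e) -> cvgn x.
Proof.
move=> cx; apply/cauchy_cvgP/cauchy_exP => e e0.
have e2 : 0 < (e / 2) ^+ 2 by rewrite exprn_gt0// divr_gt0.
have [N hN] := cx _ e2.
exists (x N); exists N => // n /= hn; rewrite -ball_normE /ball_ /=.
have := hN N n (leqnn _) hn; rewrite ler_sqr ?nnegrE ?divr_ge0 ?(ltW e0)//; lra.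
Qed.

End Inner.

(** * Convexity along segments [x + t (y - x)] *)

Section Convexity.
Context {R : realType} {H : hilbertType R}.
Implicit Types (K : set H) (x y : H) (t : R).

Let segmentE x y t : t *: y + (1 - t) *: x = x + t *: (y - x).
Proof. by rewrite scalerBl scale1r scalerBr addrCA. Qed.

Lemma convex_set_segment K x y t : convex_set K -> K x -> K y ->
  0 <= t <= 1 -> K (x + t *: (y - x)).
Proof.
move=> Kc Kx Ky /andP[t0 t1]; rewrite -segmentE.
exact: (set_mem (Kc y x (Itv01 t0 t1) (mem_set Ky) (mem_set Kx))).
Qed.

Lemma convex_function_segment K (g : H -> R) x y t :
  convex_function K g -> K x -> K y -> 0 <= t <= 1 ->
  g (x + t *: (y - x)) <= t * g y + (1 - t) * g x.
Proof.
move=> gc Kx Ky /andP[t0 t1]; rewrite -segmentE.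
exact: (gc (Itv01 t0 t1) _ _ (mem_set Ky) (mem_set Kx)).
Qed.

End Convexity.

(** * Metric projection onto a nonempty closed convex set *)

Section MetricProjection.
Context {R : realType} {H : hilbertType R}.
Variable K : set H.
Hypotheses (K0 : K !=set0) (Kclosed : closed K) (Kconvex : convex_set K).
Implicit Types x y : H.

Let parallelogram x s t : `|s - t| ^+ 2 = 2 * `|x - s| ^+ 2 +
  2 * `|x - t| ^+ 2 - 4 * `|x - (s + 2^-1 *: (t - s))| ^+ 2.
Proof.
by rewrite -!inner_norm !innerE (innerC t s) (innerC s x) (innerC t x); field.
Qed.

(** A minimizing sequence is Cauchy: midpoints stay in [K], so their squared distance to [x] is at
    least [D], and [parallelogram] leaves [|s n - s m|^2 <= 2 / (n+1) + 2 / (m+1)]. *)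
Let nearest_exists x : exists p, K p /\ forall y, K y -> `|x - p| <= `|x - y|.
Proof.
pose S := [set `|x - y| ^+ 2 | y in K]; pose D := inf S.
have hS : has_inf S.
  split; first by case: K0 => y Ky; exists (`|x - y| ^+ 2), y.
  by exists 0 => _ [y _ <-]; exact: sqr_ge0.
have DS y : K y -> D <= `|x - y| ^+ 2.
  by move=> Ky; apply: ge_inf; [exact: hS.2|exists y].
have near_inf n : exists y, K y /\ `|x - y| ^+ 2 < D + n.+1%:R^-1.
  have n0 : 0 < n.+1%:R^-1 :> R by [].
  by have [_ [y Ky <-] ?] := inf_adherent n0 hS; exists y.
have [s sP] := choice near_inf.
have cs : cvgn s.
  apply: sqr_norm_cauchy_cvg => e e0; have e4 : 0 < e / 4 by rewrite divr_gt0.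
  have [N _ /= small] := near_infty_natSinv_lt (PosNum e4).
  exists N => n m hn hm.
  have half01 : 0 <= (2^-1 : R) <= 1 by lra.
  have := DS _ (convex_set_segment Kconvex (sP n).1 (sP m).1 half01).
  have := small _ hn; have := small _ hm; have [_] := sP n; have [_] := sP m.
  rewrite (parallelogram x (s n)) /=.
  move: (m.+1%:R^-1) (n.+1%:R^-1) (`|_| ^+ 2) (`|_| ^+ 2) (`|_| ^+ 2).
  by move=> a b c d f; lra.
exists (limn s); split.
  by apply: (closed_cvg _ Kclosed _ _ cs); apply: nearW => n; exact: (sP n).1.
move=> y Ky; rewrite -ler_sqr ?nnegrE//; apply: le_trans (DS _ Ky).
have cn : `|x - s n| ^+ 2 @[n --> \oo] --> `|x - limn s| ^+ 2.
  apply: (@cvg_comp _ _ _ (fun n => `|x - s n|) (fun t : R => t ^+ 2));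
    last exact: exprn_continuous.
  by apply: cvg_norm; apply: cvgB => //; exact: cvg_cst.
have cD : D + n.+1%:R^-1 @[n --> \oo] --> D.
  rewrite -[X in _ --> X]addr0.
  by apply: cvgD; [exact: cvg_cst|exact: cvg_harmonic].
by apply: (ler_cvg_to cn cD); apply: nearW => n; apply/ltW/(sP n).2.
Qed.

Lemma metric_projP x :
  K (metric_proj K x) /\ forall y, K y -> `|x - metric_proj K x| <= `|x - y|.
Proof. exact: (xgetPex 0 (nearest_exists x)). Qed.

Lemma metric_proj_in x : K (metric_proj K x).
Proof. exact: (metric_projP x).1. Qed.

Lemma metric_proj_inner_le0 x y : K y ->
  '[x - metric_proj K x, y - metric_proj K x] <= 0.
Proof.
move=> Ky; have [Kp minp] := metric_projP x.
set p := metric_proj K x in Kp minp *.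
rewrite leNgt; apply/negP => pos; set i := '[_, _] in pos.
pose d := `|y - p| ^+ 2; have d0 : 0 <= d by exact: sqr_ge0.
(* Moving from [p] to [p + t (y - p)] changes the squared distance by [- t (2 i - t d)]. This [t]
   lies in [(0, 1]] and satisfies [t d < i], so the distance would drop. *)
pose t := i / (i + d + 1).
have den : 0 < i + d + 1 by rewrite addr_gt0// ltr_pwDl.
have t0 : 0 < t by exact: divr_gt0.
have tE : t * (i + d + 1) = i by rewrite divfK// gt_eqF.
have t1 : t <= 1 by rewrite ler_pdivrMr// mul1r; lra.
have t01 : 0 <= t <= 1 by rewrite ltW.
have := minp _ (convex_set_segment Kconvex Kp Ky t01).
rewrite -ler_sqr ?nnegrE// opprD addrA (sqr_normB (x - p)) innerZr normrZ.
rewrite exprMn (ger0_norm (ltW t0)) -/i -/d; apply/negP; rewrite -ltNge.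
suff : 0 < t * (2 * i - t * d) by lra.
apply: mulr_gt0 => //; nra.
Qed.

Lemma metric_proj_sqr_le x y : K y ->
  `|metric_proj K x - y| ^+ 2 <= `|x - y| ^+ 2 - `|x - metric_proj K x| ^+ 2.
Proof.
move=> Ky; have := metric_proj_inner_le0 x Ky; set p := metric_proj K x.
rewrite -!inner_norm !innerE (innerC p x) (innerC y x) (innerC y p); lra.
Qed.

Lemma metric_proj_le x y : K y -> `|metric_proj K x - y| <= `|x - y|.
Proof.
move=> Ky; rewrite -ler_sqr ?nnegrE//.
by apply: (le_trans (metric_proj_sqr_le x Ky)); rewrite gerBl sqr_ge0.
Qed.

End MetricProjection.

(** * Riesz representation of bounded linear functionals *)

Section Riesz.
Context {R : realType} {H : hilbertType R}.

(** If [phi] is nonzero, the point [p] of the hyperplane [phi = 1] nearest to 0 is orthogonal to the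
    kernel of [phi], and [p / |p|^2] represents [phi]. *)
Lemma riesz_representation (phi : H -> R) (M : R) :
  (forall u v, phi (u + v) = phi u + phi v) ->
  (forall a u, phi (a *: u) = a * phi u) ->
  (forall u, `|phi u| <= M * `|u|) ->
  exists q, forall v, phi v = '[q, v].
Proof.
move=> phiD phiZ phiM.
have phiN u : phi (- u) = - phi u by rewrite -scaleN1r phiZ mulN1r.
have [phi0|] := pselect (forall v, phi v = 0).
  by exists 0 => v; rewrite phi0 inner0l.
move=> /existsNP[v0 /eqP v0N0].
have phic : continuous phi.
  move=> u; apply/cvgrPdist_lt => e e0.
  have p : 0 < `|M| + 1 by rewrite ltr_wpDl.
  near=> t; rewrite -phiN -phiD; apply: (le_lt_trans (phiM _)).
  apply: (@le_lt_trans _ _ (`|u - t| * (`|M| + 1))).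
    by rewrite mulrC ler_wpM2l// (le_trans (ler_norm _)) ?lerDl.
  rewrite -ltr_pdivlMr//.
  near: t; apply: (@cvgr_dist_lt _ _ _ (nbhs u)); first exact: cvg_id.
  exact: divr_gt0.
pose K := phi @^-1` [set 1].
have K0 : K !=set0 by exists ((phi v0)^-1 *: v0); rewrite /K /= phiZ mulVf.
have Kclosed : closed K.
  by apply: preimage_closed => [u _|]; [exact: phic|exact: closed_eq].
have Kconvex : convex_set K.
  move=> u v t /set_mem Ku /set_mem Kv; apply/mem_set.
  rewrite /K /= phiD !phiZ Ku Kv /= !mulr1; by rewrite addrC subrK.
have Kp := metric_proj_in K0 Kclosed Kconvex 0; set p := metric_proj K 0 in Kp.
(* The vector [v - phi v p] is in the kernel, so both [p + d] and [p - d] stay in [K]; the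
   projection inequality with the two signs gives equality. *)
have ortho v : '[p, v - phi v *: p] = 0.
  have Kd c : K (p + c *: (v - phi v *: p)).
    by rewrite /K /= phiD phiZ phiD phiN phiZ Kp mulr1 subrr mulr0 addr0.
  have h c := metric_proj_inner_le0 K0 Kclosed Kconvex 0 (Kd c).
  have := h 1; have := h (-1).
  have subp w : p + w - p = w by rewrite addrC addKr.
  by rewrite -/p !subp sub0r !innerNl !innerZr; lra.
have p0 : `|p| ^+ 2 != 0.
  rewrite sqrf_eq0 normr_eq0; apply/eqP => p0; move: Kp; rewrite /K /= p0.
  by rewrite -(scale0r 0) phiZ mul0r => /esym/eqP; rewrite oner_eq0.
exists ((`|p| ^+ 2)^-1 *: p) => v; have := ortho v.
rewrite !innerE inner_norm => /eqP; rewrite subr_eq0 => /eqP ->.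
by rewrite mulrC mulfK.
Unshelve. all: by end_near. Qed.

End Riesz.

(** * Operator norm and adjoint *)

Section Adjoint.
Context {R : realType} {H1 H2 : hilbertType R}.
Variable A : {linear H1 -> H2}.
Hypothesis Abounded : bounded_fun_norm A.

Lemma opnorm_ge0 : 0 <= opnorm A.
Proof.
have [M AM] := Abounded 1; apply: ub_le_sup; last first.
  by exists 0; rewrite /= ?linear0 ?normr0.
by exists M => _ [v /= v1 <-]; exact: AM.
Qed.

Lemma le_opnorm v : `|A v| <= opnorm A * `|v|.
Proof.
have [->|v0] := eqVneq v 0; first by rewrite linear0 !normr0 mulr0.
have vp : 0 < `|v| by rewrite normr_gt0.
rewrite -ler_pdivrMr//; have [M AM] := Abounded 1; apply: ub_le_sup.
  by exists M => _ [w /= w1 <-]; exact: AM.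
exists (`|v|^-1 *: v) => /=.
  by rewrite normrZ normfV normr_id mulVf ?gt_eqF.
by rewrite linearZ normrZ normfV normr_id mulrC.
Qed.

Lemma adjointP x y : '[A x, y] = '[x, adjoint A y].
Proof.
have [q qP] : exists q, forall x, '[A x, y] = '[q, x].
  apply: (riesz_representation (M := opnorm A * `|y|)).
  - by move=> u v; rewrite linearD innerDl.
  - by move=> a u; rewrite linearZ innerZl.
  - move=> u; apply: (le_trans (CauchySchwarz_inner _ _)).
    by rewrite mulrAC ler_wpM2r// le_opnorm.
have qadj : [set z | forall x, '[A x, y] = '[x, z]] q.
  by move=> u /=; rewrite qP innerC.
exact: (xgetPex 0 (ex_intro _ q qadj)).
Qed.

(** Divide [|A* y|^2 = '[A (A* y), y] <= |A| |A* y| |y|] by [|A* y|]. *)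
Lemma norm_adjoint_le y : `|adjoint A y| <= opnorm A * `|y|.
Proof.
have [->|n0] := eqVneq (adjoint A y) 0.
  by rewrite normr0 mulr_ge0 ?opnorm_ge0.
have np : 0 < `|adjoint A y| by rewrite normr_gt0.
rewrite -(ler_pM2r np) -expr2 -inner_norm -adjointP.
apply: (le_trans (inner_le_norm _ _)).
by rewrite mulrAC ler_wpM2r// le_opnorm.
Qed.

Lemma bounded_linear_continuous : continuous A.
Proof.
move=> x; apply/cvgrPdist_lt => e e0.
have p : 0 < opnorm A + 1 by rewrite ltr_wpDl ?opnorm_ge0.
near=> t; rewrite -linearB.
apply: (le_lt_trans (le_opnorm _)).
apply: (@le_lt_trans _ _ (`|x - t| * (opnorm A + 1))).
  by rewrite mulrC ler_wpM2l// lerDl.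
rewrite -ltr_pdivlMr//.
near: t; apply: (@cvgr_dist_lt _ _ _ (nbhs x)); first exact: cvg_id.
exact: divr_gt0.
Unshelve. all: by end_near. Qed.

End Adjoint.

(** * Limits of bounded real sequences along ultrafilters *)

Section UltrafilterLimits.
Context {R : realType} {F : set_system nat}.

(** Compactness of [[-B, B]] gives a cluster point, and an ultrafilter converges to each of its
    cluster points. *)
Lemma ultra_bounded_cvg (FU : UltraFilter F) (r : nat -> R) (B : R) :
  (forall n, `|r n| <= B) -> exists l : R, r n @[n --> F] --> l.
Proof.
have FP : ProperFilter F by exact: ultra_proper.
move=> rB; have comp := @segment_compact R (- B) B.
have rFin : F (r @^-1` [set` `[- B, B]]).
  by apply: filterE => n /=; rewrite in_itv/= -ler_norml; exact: rB.
have [l [_ clus]] := comp (r @ F) _ rFin; exists l => U nU /=.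
have [//|notU] := in_ultra_setVsetC (r @^-1` U) FU.
have [t [tnU tU]] := clus (~` U) U notU nU; contradiction.
Qed.

End UltrafilterLimits.

(** * Weak limits along filters and weak compactness *)

Section WeakLimits.
Context {R : realType} {H : hilbertType R}.
Implicit Types (F : set_system nat) (x : nat -> H) (q : H).

(* Proper filters finer than [\oo] play the role of subsequences. *)
Definition weak_limit F x q := forall v, '[x n, v] @[n --> F] --> '[q, v].

(** An ultrafilter makes ['[x n, v]] converge for all [v] at once, without diagonal extraction; the
    limits form a bounded linear functional, which Riesz represents by [q]. *)
Lemma bounded_ultra_weak_limit F (FU : UltraFilter F) x (B : R) :
  (forall n, `|x n| <= B) -> exists q, weak_limit F x q.
Proof.
move=> xB.
have /choice[phi phiP] : forall v, exists l : R, '[x n, v] @[n --> F] --> l.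
  move=> v; apply: (ultra_bounded_cvg FU (B := B * `|v|)) => n.
  by apply: (le_trans (CauchySchwarz_inner _ _)); rewrite ler_wpM2r.
have FP : ProperFilter F by exact: ultra_proper.
have uniq (r : nat -> R) (l l' : R) :
    r n @[n --> F] --> l -> r n @[n --> F] --> l' -> l = l'.
  by apply: cvg_unique; exact: Rhausdorff.
have phiB v : `|phi v| <= B * `|v|.
  apply: (cvgr_to_le (cvg_norm (phiP v))); apply: nearW => n.
  by apply: (le_trans (CauchySchwarz_inner _ _)); rewrite ler_wpM2r.
have [||q qP] := riesz_representation _ _ phiB.
- move=> u v; apply: (uniq (fun n => '[x n, u + v])) => //.
  under eq_fun do rewrite innerDr; exact: cvgD.
- move=> a u; apply: (uniq (fun n => '[x n, a *: u])) => //.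
  under eq_fun do rewrite innerZr; apply: cvgM => //; exact: cvg_cst.
by exists q => v; rewrite -qP.
Qed.

Lemma subsequence_weak_limit x (B : R) (P : nat -> set nat) :
  (forall n, `|x n| <= B) -> (forall j k n, (j <= k)%N -> P k n -> P j n) ->
  (forall k, exists n, (k <= n)%N /\ P k n) ->
  exists F, [/\ ProperFilter F, \oo `<=` F, forall k, F (P k) &
    exists q, weak_limit F x q].
Proof.
move=> xB Pmono /choice[s sP].
have [U [UU ooU]] := ultraFilterLemma (F := \oo) _.
have UP : ProperFilter U by exact: ultra_proper.
have tail (T : set nat) N : (forall k, (N <= k)%N -> T (s k)) -> U (s @^-1` T).
  by move=> NT; apply: ooU; exists N.
have [q xsq] := bounded_ultra_weak_limit UU (fun n => xB (s n)).
(* The choice [s] need not be increasing: [k <= s k] suffices for its image filter to refine [\oo],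
   and monotonicity of [P] puts every [P k] in it. *)
exists (s @ U); split.
- exact: fmap_proper_filter.
- move=> T [N _ NT]; apply: (tail T N) => k Nk; apply: NT.
  exact: leq_trans Nk (sP k).1.
- by move=> k; apply: (tail (P k) k) => j kj; exact: Pmono kj (sP j).2.
- by exists q => v; exact: xsq.
Qed.

Lemma weak_limit_cvg0 F {FF : Filter F} x y q :
  weak_limit F x q -> `|y n - x n| @[n --> F] --> (0 : R) -> weak_limit F y q.
Proof.
move=> xq yx v.
have -> : (fun n => '[y n, v]) = (fun n => '[x n, v] + '[y n - x n, v]).
  by apply/funext => n; rewrite -innerDl addrC subrK.
rewrite -[X in _ --> X]addr0; apply: cvgD => //.
apply: norm_cvg0.
apply: (@squeeze_cvgr _ _ _ _ (cst 0) (fun n => `|y n - x n| * `|v|)).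
- by apply: nearW => n /=; rewrite normr_ge0 CauchySchwarz_inner.
- exact: cvg_cst.
- by rewrite -[X in _ --> X](mul0r `|v|); apply: cvgM => //; exact: cvg_cst.
Qed.

(** Test the weak limit against [q - p]: the inequality ['[x n - p, q - p] <= 0] passes to the limit
    as [|q - p|^2 <= 0]. *)
Lemma weak_limit_closed_convex F {FF : ProperFilter F} K x q :
  K !=set0 -> closed K -> convex_set K -> (forall n, K (x n)) ->
  weak_limit F x q -> K q.
Proof.
move=> K0 Kc Kv Kx xq; set p := metric_proj K q.
suff /eqP : `|q - p| ^+ 2 = 0.
  rewrite sqrf_eq0 normr_eq0 subr_eq0 => /eqP ->; exact: metric_proj_in.
apply/eqP; rewrite eq_le sqr_ge0 andbT -inner_norm.
have : '[x n - p, q - p] @[n --> F] --> '[q - p, q - p].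
  under eq_fun do rewrite innerDl; rewrite innerDl.
  by apply: cvgD => //; exact: cvg_cst.
move/cvgr_to_le; apply; apply: nearW => n; rewrite innerC.
exact: metric_proj_inner_le0.
Qed.

(** Intended for [p n] the projection of [x n]. Replacing [q - p n] by [q - l] costs at most
    [B |p n - l|], which tends to 0, so in the limit [|q - l|^2 <= 0]. *)
Lemma weak_limit_obtuse F {FF : ProperFilter F} x (p : nat -> H) q l (B : R) :
  weak_limit F x q -> p n @[n --> F] --> l -> (forall n, `|x n - p n| <= B) ->
  (forall n, '[x n - p n, q - p n] <= 0) -> q = l.
Proof.
move=> xq pl xpB obtuse; apply/eqP; rewrite -subr_eq0 -normr_eq0 -sqrf_eq0.
rewrite eq_le sqr_ge0 andbT -inner_norm.
have lim_inner : '[x n - p n, q - l] @[n --> F] --> '[q - l, q - l].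
  under eq_fun do rewrite innerDl innerNl; rewrite innerDl innerNl.
  apply: cvgB; first exact: xq.
  apply: (@cvg_comp _ _ _ p (fun u => '[u, q - l]) F (nbhs l)) => //.
  exact: inner_continuousl.
have lim_norm : B * `|p n - l| @[n --> F] --> 0.
  rewrite -[X in _ --> X](mulr0 B); apply: cvgM; first exact: cvg_cst.
  rewrite -[X in _ --> X](@normr0 _ H) -[X in `|X|](subrr l).
  by apply: cvg_norm; apply: cvgB => //; exact: cvg_cst.
apply: (ler_cvg_to lim_inner lim_norm); apply: nearW => n.
have -> : q - l = (q - p n) + (p n - l) by rewrite addrA subrK.
rewrite innerDr -[leRHS]add0r lerD//.
by apply: (le_trans (inner_le_norm _ _)); rewrite ler_wpM2r.
Qed.

Lemma weak_limitP F {FF : Filter F} x q :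
  weak_limit F x q -> x @ F --> (q : weak H).
Proof.
pose g := fun x : H => (fun v => '[x, v]) : {ptws H -> R^o}.
move=> xq; have gxq : {ptws, g \o x @ F --> g q} by apply/pointwise_cvgP.
move=> U /= [_ /= [[B oB <-] /= Bgl]] /filterS; apply.
by apply: gxq; exact: open_nbhs_nbhs.
Qed.

(** Asking only for eventual lower bounds [l - e] covers both values that are nonnegative and values
    that tend to 0. *)
Lemma weakly_usc_limit F {FF : ProperFilter F} K (h : H -> R) x q (l : R) :
  weakly_usc_on K h -> (forall n, K (x n)) -> K q -> weak_limit F x q ->
  (forall e, 0 < e -> \forall n \near F, l - e <= h (x n)) -> l <= h q.
Proof.
move=> husc Kx Kq xq hl; rewrite leNgt; apply/negP => hq.
pose e := (l - h q) / 2; have e0 : 0 < e by rewrite divr_gt0 ?subr_gt0.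
have [|V nV Vh] := husc q (- (l - e)).
  by rewrite lte_fin /e; lra.
have xV : \forall n \near F, V (x n).
  have : nbhs (q : weak H) [set y | K y -> V y].
    by move: nV; rewrite /nbhs /= -nbhs_subspace_in//.
  move=> /(weak_limitP xq) xV.
  apply: (@filterS _ F _ (x @^-1` [set y | K y -> V y])) => // n.
  by apply; exact: Kx.
have [n [/= h1 h2]] := filter_ex (filterI (hl e e0) xV).
by have := Vh _ h2; rewrite lte_fin ltrN2 ltNge h1.
Qed.

Lemma lsc_on_sublevel_closed K (h : H -> R) (c : R) :
  closed K -> lsc_on K h -> closed [set y | K y /\ h y <= c].
Proof.
move=> Kc hlsc y cy.
have Ky : K y.
  by apply: Kc => U /cy [z [[Kz _] Uz]]; exists z.
split=> //; rewrite leNgt; apply/negP => hy.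
have [|V nV Vh] := hlsc y c; first by rewrite lte_fin.
have : nbhs y [set z | K z -> V z].
  by move: nV; rewrite /nbhs /= -nbhs_subspace_in//.
move=> /cy[z [[Kz hz] /(_ Kz)/Vh]]; rewrite lte_fin ltNge hz; by [].
Qed.

End WeakLimits.

(** * Structure of the equilibrium set and its weak limits *)

Section EquilibriumSet.
Context {R : realType} {H : hilbertType R}.
Variables (eps : nat -> R) (K : set H) (g : H -> H -> R).
Hypotheses (Kclosed : closed K) (Kconvex : convex_set K).
Hypothesis gP : equilibrium_assumptions eps K g.

(* Minty: weak upper semicontinuity is used along the segment from x to y. *)
Lemma EP_minty x : EP g K x <-> K x /\ forall y, K y -> g y x <= 0.
Proof.
split=> [[Kx gx]|[Kx gx]].
  by split=> // y Ky; apply: (eqa_pseudomonotone gP) => //; exact: gx.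
split=> // y Ky.
pose t n : R := n.+1%:R^-1; pose s n := x + t n *: (y - x).
have t0 n : 0 < t n by rewrite invr_gt0.
have t1 n : t n <= 1 by rewrite invf_le1// ler1n.
have t01 n : 0 <= t n <= 1 by rewrite t1 andbT ltW.
have Ks n : K (s n) by exact: convex_set_segment.
have sx : weak_limit \oo s x.
  move=> v.
  have : '[x, v] + t n * '[y - x, v] @[n --> \oo] --> '[x, v] + 0 * '[y - x, v].
    apply: cvgD; first exact: cvg_cst.
    by apply: cvgM; [exact: cvg_harmonic|exact: cvg_cst].
  rewrite mul0r addr0; apply: cvg_trans; apply: near_eq_cvg.
  by apply: nearW => n; rewrite (innerDl x) innerZl.
apply: (weakly_usc_limit (eqa_weakly_usc gP Ky) Ks Kx sx) => e e0.
apply: nearW => n.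
apply: (@le_trans _ _ 0); first by rewrite sub0r oppr_le0 ltW.
(* From [0 = g (s n) (s n) <= t g (s n) y + (1 - t) g (s n) x] and [g (s n) x <= 0] follows
   [0 <= g (s n) y]. *)
have := convex_function_segment (eqa_convex gP (Ks n)) Kx Ky (t01 n).
rewrite -/(s n) (eqa_diag gP (Ks n)) => h.
rewrite -(pmulr_rge0 _ (t0 n)); apply: (le_trans h); rewrite gerDl.
by rewrite mulr_ge0_le0 ?subr_ge0//; exact: gx.
Qed.

(** The Minty form is an intersection of sublevel sets of the functions [g y], so lower
    semicontinuity in the second variable applies; their convexity gives [EP_convex] in the same
    way. *)
Lemma EP_closed : closed (EP g K).
Proof.
have -> : EP g K = K `&` \bigcap_(y in K) [set x | K x /\ g y x <= 0].
  apply/seteqP; split => x.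
    by move=> /EP_minty[Kx gx]; split=> // y Ky; split => //; exact: gx.
  by move=> [Kx gx]; apply/EP_minty; split=> // y Ky; exact: (gx y Ky).2.
apply: closedI => //; apply: closed_bigI => y Ky.
exact: lsc_on_sublevel_closed Kclosed (eqa_lsc gP Ky).
Qed.

Lemma EP_convex : convex_set (EP g K).
Proof.
move=> x y t /set_mem/EP_minty[Kx gx] /set_mem/EP_minty[Ky gy].
apply/mem_set/EP_minty; split.
  exact: (set_mem (Kconvex t (mem_set Kx) (mem_set Ky))).
move=> z Kz.
apply: (le_trans (eqa_convex gP Kz t (mem_set Kx) (mem_set Ky))).
have t0 : 0 <= t%:num by []. have t1 : t%:num <= 1 by [].
rewrite convRE -[leRHS]addr0 lerD// mulr_ge0_le0 ?gx ?gy//.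
by rewrite subr_ge0.
Qed.

Lemma bounded_subgradients (v w : nat -> H) (B : R) :
  (forall n, K (v n)) -> (forall n, `|v n| <= B) ->
  (forall n, subdiff (eps n) K (g (v n)) (v n) (w n)) ->
  exists L : R, forall n, `|w n| <= L.
Proof.
move=> Kv vB wP.
have rK : range v `<=` K by move=> _ [n _ <-].
have rB : bounded_set (range v).
  exists B; split; first exact: num_real.
  by move=> M BM _ [n _ <-]; exact: le_trans (vB n) (ltW BM).
have [M [_ bM]] := eqa_bounded_subdiff gP rK rB.
(* [bounded_set] only provides bounds strictly above [M]. *)
exists (M + 1) => n; apply: (bM (M + 1)); first by rewrite ltrDl.
by exists n => //; exists (v n) => //; exists n.
Qed.

(** By [eqa_closed_zero] only [g q p = 0] is needed: Minty at [p] gives [<=], weak upper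
    semicontinuity in the first variable gives [>=]. *)
Lemma EP_weak_limit (F : set_system nat) (FF : ProperFilter F) z p q :
  EP g K p -> K q -> (forall n, K (z n)) -> weak_limit F z q ->
  g (z n) p @[n --> F] --> (0 : R) -> EP g K q.
Proof.
move=> EPp Kq Kz zq gz; have Kp := EPp.1.
apply: (eqa_closed_zero gP EPp Kq); apply/eqP; rewrite eq_le; apply/andP; split.
  exact: (proj1 (EP_minty p) EPp).2.
apply: (weakly_usc_limit (eqa_weakly_usc gP Kp) Kz Kq zq) => e e0.
move/cvgrPdist_le : gz => /(_ _ e0); apply: filterS => n.
by rewrite sub0r normrN ler_norml sub0r => /andP[].
Qed.

End EquilibriumSet.

(** * Series and quasi-Fejer real sequences *)

Section RealSequences.
Context {R : realType}.
Implicit Types (s a eta : nat -> R).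

Lemma bounded_cvg_series s (B : R) : (forall n, 0 <= s n) ->
  (forall n, series s n <= B) -> cvgn (series s).
Proof.
move=> s0 sB; apply: nondecreasing_is_cvgn.
  by apply: nondecreasing_series => n _ _; exact: s0.
by exists B => _ [n _ <-].
Qed.

Lemma series_le_lim s n : (forall n, 0 <= s n) -> cvgn (series s) ->
  series s n <= limn (series s).
Proof.
move=> s0 cs; apply: nondecreasing_cvgn_le => //.
by apply: nondecreasing_series => k _ _; exact: s0.
Qed.

(** Reconciles sums that start at index 1 with [series], which starts at 0. *)
Let series_split0 s n : series s n.+1 = s 0%N + \sum_(1 <= i < n.+1) s i.
Proof. by rewrite seriesEnat/= big_nat_recl// big_add1. Qed.

Lemma cvg_series_nneseries s : (forall n, 0 <= s n) ->
  (\sum_(1 <= n <oo) (s n)%:E < +oo)%E -> cvgn (series s).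
Proof.
move=> s0; set S := (X in (X < _)%E) => Sfin.
have S0 : (0 <= S)%E by apply: nneseries_ge0 => n _ _; rewrite lee_fin.
have partial n : \sum_(1 <= i < n) s i <= fine S.
  rewrite -lee_fin fineK ?ge0_fin_numE// -sumEFin.
  by apply: nneseries_lim_ge => i _ _; rewrite lee_fin.
apply: (bounded_cvg_series (B := s 0%N + fine S)) => // -[|n].
  by rewrite seriesEnat/= big_geq// addr_ge0// fine_ge0.
by rewrite series_split0 lerD2l.
Qed.

Lemma not_cvg_series_nneseries s : (forall n, 0 <= s n) ->
  (\sum_(1 <= n <oo) (s n)%:E = +oo)%E -> ~ cvgn (series s).
Proof.
move=> s0 + cs; apply/eqP; rewrite lt_eqF//.
apply: (@le_lt_trans _ _ (limn (series s))%:E); last exact: ltry.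
apply: lime_le; first by apply: is_cvg_nneseries => n _ _; rewrite lee_fin.
apply: nearW => -[|n]; rewrite sumEFin lee_fin.
  rewrite big_geq//; apply: le_trans (series_le_lim 0 s0 cs).
  by rewrite seriesEnat/= big_geq.
by apply: le_trans (series_le_lim n.+1 s0 cs); rewrite series_split0 lerDr.
Qed.

Lemma cvg_oscillation a (e : R) : cvgn a -> 0 < e ->
  exists N, forall n m, (N <= n)%N -> (N <= m)%N -> `|a n - a m| <= e.
Proof.
move=> ca e0; have e2 : 0 < e / 2 by rewrite divr_gt0.
have [N _ aN] := (cvgrPdist_le _ _).1 ca _ e2.
exists N => n m hn hm; rewrite (splitr e) -(subrK (limn a) (a n)) -addrA.
by apply: (le_trans (ler_normD _ _)); rewrite lerD ?aN// distrC aN.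
Qed.

Lemma cvg_norm_bounded (V : normedModType R) (v : nat -> V) : cvgn v ->
  exists B : R, forall n, `|v n| <= B.
Proof.
move=> /cvg_seq_bounded[M [_ bM]]; exists (M + 1) => n.
by apply: (bM (M + 1) _ n) => //; rewrite ltrDl.
Qed.

(** The sequence [a - series eta] is nonincreasing and bounded below. *)
Lemma quasi_fejer_cvg a eta : (forall n, 0 <= a n) ->
  cvgn (series eta) -> (forall n, a n.+1 <= a n + eta n) -> cvgn a.
Proof.
move=> a0 ceta aS.
have -> : a = (a \- series eta) \+ series eta.
  by apply/funext => n /=; rewrite subrK.
apply: is_cvgD => //; apply: nonincreasing_is_cvgn.
  apply/nonincreasing_seqP => n /=; rewrite seriesSr; have := aS n; lra.
have [B bB] := cvg_norm_bounded ceta.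
exists (- B) => _ [n _ <-] /=; have := a0 n; have := bB n.
rewrite ler_norml => /andP[]; lra.
Qed.

Lemma quasi_fejer_series a c eta :
  (forall n, 0 <= a n) -> (forall n, 0 <= c n) ->
  cvgn (series eta) -> (forall n, a n.+1 + c n <= a n + eta n) ->
  cvgn (series c).
Proof.
move=> a0 c0 ceta aS; have [B bB] := cvg_norm_bounded ceta.
apply: (bounded_cvg_series (B := a 0%N + B)) => // n.
have h : a n + series c n <= a 0%N + series eta n.
  elim: n => [|n IHn]; first by rewrite !seriesEnat/= !big_geq.
  by rewrite !seriesSr; have := aS n; lra.
have := a0 n; have := bB n.
rewrite ler_norml => /andP[]; lra.
Qed.

(* [phi] decreases by at most the oscillation of a convergent sequence as long
   as [D <= phi], where [tau] is controlled by the summable [tau * G]; a single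
   late value above [3 D] would thus keep [phi >= D] and make [tau] summable. *)
Lemma eventually_small_of_drift (phi b tau eta G : nat -> R) (C D delta : R)
    (N0 : nat) :
  0 <= C -> 0 < D -> 0 < delta -> (forall n, 0 <= tau n) ->
  (forall n, 0 <= G n) ->
  cvgn b -> cvgn (series eta) -> cvgn (series (fun n => tau n * G n)) ->
  ~ cvgn (series tau) ->
  (forall n, phi n + (b n.+1 - b n) - (C * tau n + eta n) <= phi n.+1) ->
  (forall n, (N0 <= n)%N -> D <= phi n -> delta <= G n) ->
  exists N, forall n, (N <= n)%N -> phi n < 3 * D.
Proof.
move=> C0 D0 d0 tau0 G0 cb ceta ctG nctau phiS GN; apply: contrapT => notN.
pose T := series (fun n => tau n * G n).
(* While [D <= phi], [C tau] is at most [C / delta] times the increment of [T], so [phi] decreases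
   no more than [psi] does. Past [N1], [psi] varies by at most [D], hence [phi] stays above
   [2 D]. *)
pose psi n := b n - series eta n - C / delta * T n.
have cpsi : cvgn psi.
  by apply: is_cvgB; [exact: is_cvgB|apply: is_cvgM => //; exact: is_cvg_cst].
have [N1 osc] := cvg_oscillation cpsi D0.
have [n [nN phin]] : exists n, (maxn N0 N1 <= n)%N /\ 3 * D <= phi n.
  apply: contrapT => h; apply: notN; exists (maxn N0 N1) => n nN.
  by rewrite ltNge; apply/negP => phin; apply: h; exists n.
move: nN; rewrite geq_max => /andP[nN0 nN1].
have tauG k : (N0 <= k)%N -> D <= phi k -> tau k <= delta^-1 * (tau k * G k).
  move=> Nk Dk; rewrite mulrC -ler_pdivrMr ?invr_gt0// invrK ler_wpM2l//.
  exact: GN.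
have above k : 3 * D + (psi (n + k)%N - psi n) <= phi (n + k)%N.
  elim: k => [|k IHk]; first by rewrite addn0 subrr addr0.
  have Dk : D <= phi (n + k)%N.
    have := osc (n + k)%N n (leq_trans nN1 (leq_addr _ _)) nN1.
    by rewrite ler_norml => /andP[? _]; lra.
  rewrite addnS; apply: le_trans (phiS _).
  have := tauG _ (leq_trans nN0 (leq_addr _ _)) Dk.
  move/(ler_wpM2l C0); rewrite mulrA.
  by move: IHk; rewrite /psi /T !seriesSr /=; lra.
apply: nctau.
apply: (bounded_cvg_series (B := series tau n + delta^-1 * limn T)) => // m.
apply: (@le_trans _ _ (series tau (n + m)%N)).
  by apply: (nondecreasing_series (fun k _ _ => tau0 k)); exact: leq_addl.
apply: (@le_trans _ _ (series tau n + delta^-1 * (T (n + m)%N - T n))).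
  elim: m => [|m IHm]; first by rewrite addn0 subrr mulr0 addr0.
  have Dm : D <= phi (n + m)%N.
    apply: le_trans (above m).
    have := osc (n + m)%N n (leq_trans nN1 (leq_addr _ _)) nN1.
    by rewrite ler_norml => /andP[? _]; lra.
  have := tauG _ (leq_trans nN0 (leq_addr _ _)) Dm.
  by rewrite addnS seriesSr {1}/T seriesSr -/T /=; lra.
have tG0 k : 0 <= tau k * G k by rewrite mulr_ge0.
rewrite lerD2l ler_wpM2l ?invr_ge0 ?(ltW d0)//.
have := series_le_lim (n + m) tG0 ctG; rewrite -/T.
have : 0 <= T n by rewrite /T seriesEnat/= sumr_ge0.
lra.
Qed.

End RealSequences.

(** * Quasi-Fejer sequences in a Hilbert space *)

Section FejerMonotonicity.
Context {R : realType} {H : hilbertType R}.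
Variables (S : set H) (x : nat -> H) (eta : nat -> R).
Hypotheses (S0 : S !=set0) (Sclosed : closed S) (Sconvex : convex_set S).
Hypothesis ceta : cvgn (series eta).
Hypothesis fejer : forall p n, S p ->
  `|x n.+1 - p| ^+ 2 <= `|x n - p| ^+ 2 + eta n.

Lemma quasi_fejer_dist_cvg p : S p -> cvgn (fun n => `|x n - p| ^+ 2).
Proof.
move=> Sp.
by apply: (quasi_fejer_cvg _ ceta) => n; [exact: sqr_ge0|exact: fejer].
Qed.

Lemma quasi_fejer_bounded : exists B : R, forall n, `|x n| <= B.
Proof.
have [p Sp] := S0; have [B dB] := cvg_norm_bounded (quasi_fejer_dist_cvg Sp).
(* [B] bounds the squared distance, and [t <= t^2 + 1]. *)
exists (B + 1 + `|p|) => n; rewrite -[x n](subrK p).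
apply: (le_trans (ler_normD _ _)); rewrite lerD2r.
have := dB n; rewrite ger0_norm ?sqr_ge0//; nra.
Qed.

Lemma quasi_fejer_proj_cvg : cvgn (fun n => metric_proj S (x n)).
Proof.
pose p n := metric_proj S (x n); pose d n := `|x n - p n| ^+ 2.
have Sp n : S (p n) by exact: metric_proj_in.
(* [p n] competes with the nearest point [p n.+1], so [d n.+1 <= |x n.+1 - p n|^2 <= d n + eta
   n]. *)
have cd : cvgn d.
  apply: (quasi_fejer_cvg _ ceta) => n; first exact: sqr_ge0.
  apply: (le_trans _ (fejer n (Sp n))); rewrite ler_sqr ?nnegrE//.
  by apply: (metric_projP _ _ _ _).2.
(* the summed Fejer inequality bounds the squared distance of two projections
   by the oscillation of [d - series eta] *)
have dist n k : `|p (n + k)%N - p n| ^+ 2 <=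
    (d n - series eta n) - (d (n + k)%N - series eta (n + k)%N).
  have fejer_sum : `|x (n + k)%N - p n| ^+ 2 <=
      d n + (series eta (n + k)%N - series eta n).
    elim: k => [|k IHk]; first by rewrite addn0 subrr addr0.
    by rewrite addnS seriesSr; have := fejer (n + k) (Sp n); lra.
  have := metric_proj_sqr_le S0 Sclosed Sconvex (x (n + k)%N) (Sp n).
  by rewrite -/(p _) -/(d _); lra.
have cpsi : cvgn (fun n => d n - series eta n) by exact: is_cvgB.
apply: sqr_norm_cauchy_cvg => e e0; have [N osc] := cvg_oscillation cpsi e0.
exists N => n m; wlog nm : n m / (n <= m)%N => [hw|hn hm].
  have [/hw//|/ltnW/hw h] := leqP n m.
  by move=> hn hm; rewrite -normrN opprB; exact: h.
have := osc n m hn hm; have := dist n (m - n)%N; rewrite subnKC// => h1 h2.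
rewrite -normrN opprB; apply: (le_trans h1); exact: (le_trans (ler_norm _) h2).
Qed.

End FejerMonotonicity.

(** * One-step estimates for the algorithm *)

Section ProjectionSteps.
Context {R : realType}.

(** Both [r] and [t] are at most [L r / rho]. With bounded subgradients the actual step sizes are
    thus comparable to [tau]. *)
Lemma stepsize_ge (rho r t L b : R) : 0 < rho -> rho <= r -> rho <= L ->
  t <= L -> 0 <= b -> rho / L * (b / r) <= b / Num.max r t.
Proof.
move=> rho0 rr rL tL b0; have r0 : 0 < r by exact: lt_le_trans rr.
have L0 : 0 < L by exact: lt_le_trans rL.
have max0 : 0 < Num.max r t by rewrite lt_max r0.
have max_le : Num.max r t <= L * r / rho.
  by rewrite ge_max !ler_pdivlMr//; apply/andP; split; nra.
have -> : rho / L * (b / r) = b / (L * r / rho) by field; rewrite !gt_eqF.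
by rewrite ler_wpM2l// lef_pV2 ?posrE// divr_gt0 ?mulr_gt0.
Qed.

(** Projecting does not increase the distance to [s]; then expand the square. The vector [g] is
    arbitrary, so the estimate also serves points that solve no equilibrium problem. *)
Lemma proj_subgradient_step (H : hilbertType R) (K : set H) (z g s : H)
    (al be : R) :
  K !=set0 -> closed K -> convex_set K -> K s -> 0 <= al -> al * `|g| <= be ->
  `|metric_proj K (z - al *: g) - s| ^+ 2 <=
  `|z - s| ^+ 2 + 2 * al * '[g, s - z] + be ^+ 2.
Proof.
move=> K0 Kc Kv Ks al0 alg.
have h : `|metric_proj K (z - al *: g) - s| ^+ 2 <= `|z - al *: g - s| ^+ 2.
  by rewrite ler_sqr ?nnegrE//; exact: metric_proj_le.
apply: (le_trans h); rewrite addrAC (sqr_normB (z - s)) normrZ ger0_norm//.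
have : (al * `|g|) ^+ 2 <= be ^+ 2.
  by rewrite ler_sqr ?nnegrE ?mulr_ge0// (le_trans _ alg)// mulr_ge0.
rewrite !innerE (innerC g z) (innerC g s). lra.
Qed.

(** The adjoint turns the cross term into [2 m '[A x - A s, y - A x]], which polarizes into [m (|y -
    A s|^2 - |A x - A s|^2 - |y - A x|^2)]; the last term absorbs the quadratic one. *)
Lemma split_step (H1 H2 : hilbertType R) (C : set H1) (A : {linear H1 -> H2})
    (x s : H1) (y : H2) (m : R) : bounded_fun_norm A ->
  C !=set0 -> closed C -> convex_set C -> C s -> 0 <= m ->
  m * `|adjoint A (y - A x)| ^+ 2 <= `|y - A x| ^+ 2 ->
  `|metric_proj C (x + m *: adjoint A (y - A x)) - s| ^+ 2 <=
  `|x - s| ^+ 2 + m * (`|y - A s| ^+ 2 - `|A x - A s| ^+ 2).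
Proof.
move=> Ab C0 Cc Cv Cs m0 mA; set v := adjoint A _ in mA *.
have h : `|metric_proj C (x + m *: v) - s| ^+ 2 <= `|x + m *: v - s| ^+ 2.
  by rewrite ler_sqr ?nnegrE//; exact: metric_proj_le.
apply: (le_trans h); rewrite addrAC (sqr_normD (x - s)) normrZ ger0_norm//.
rewrite innerZr -adjointP// [A (x - s)]linearB.
have := ler_wpM2l m0 mA.
have -> : y - A s = (y - A x) + (A x - A s) by rewrite addrA subrK.
rewrite (sqr_normD (y - A x)) (innerC (y - A x)); lra.
Qed.

End ProjectionSteps.

(** * Convergence of the algorithm *)

Section Convergence.
Context {R : realType} {H1 H2 : hilbertType R}.
Variables (C : set H1) (Q : set H2) (A : {linear H1 -> H2}).
Variables (f : H1 -> H1 -> R) (F : H2 -> H2 -> R).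
Variables (rho_ beta eps mu : nat -> R) (rho a : R).
Hypotheses (C0 : C !=set0) (Cclosed : closed C) (Cconvex : convex_set C).
Hypotheses (Q0 : Q !=set0) (Qclosed : closed Q) (Qconvex : convex_set Q).
Hypothesis Abounded : bounded_fun_norm A.
Hypotheses (rho_gt0 : 0 < rho) (a_gt0 : 0 < a).
Hypothesis rho_ge : forall n, rho <= rho_ n.
Hypothesis eps_ge0 : forall n, 0 <= eps n.
Hypothesis beta_gt0 : forall n, 0 < beta n.
Hypothesis mu_ge : forall n, a <= mu n.
Hypothesis mu_le : forall n, ((mu n)%:E <= 1 / (opnorm A ^+ 2)%:E)%E.
Hypothesis f_assumptions : equilibrium_assumptions eps C f.
Hypothesis F_assumptions : equilibrium_assumptions eps Q F.
Variables (x z g : nat -> H1) (u w y : nat -> H2).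
Hypothesis x_alg :
  projection_algorithm C Q A f F rho_ beta eps mu x z g u w y.

Let Omega := solution_set C Q A f F.
Hypothesis Omega0 : Omega !=set0.

Let tau n := beta n / rho_ n.
Hypothesis dvg_tau : ~ cvgn (series tau).
Hypothesis cvg_tau_eps : cvgn (series (fun n => tau n * eps n)).
Hypothesis cvg_beta2 : cvgn (series (fun n => beta n ^+ 2)).

Let alpha n := beta n / Num.max (rho_ n) `|g n|.
Let gamma n := beta n / Num.max (rho_ n) `|w n|.

Let rho_n_gt0 n : 0 < rho_ n. Proof. exact: lt_le_trans (rho_ge n). Qed.
Let tau_ge0 n : 0 <= tau n. Proof. by rewrite divr_ge0 ?ltW. Qed.

Let stepsize_ge0 n (t : R) : 0 <= beta n / Num.max (rho_ n) t.
Proof. by rewrite divr_ge0 ?ltW// lt_max rho_n_gt0. Qed.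

Let stepsize_le_tau n (t : R) : beta n / Num.max (rho_ n) t <= tau n.
Proof.
have le_maxl : rho_ n <= Num.max (rho_ n) t by rewrite le_max lexx.
apply: ler_wpM2l; first exact: ltW.
by rewrite lef_pV2 ?posrE ?lt_max ?rho_n_gt0.
Qed.

Let stepsize_norm n (t : R) : 0 <= t ->
  beta n / Num.max (rho_ n) t * t <= beta n.
Proof.
move=> t0; have max0 : 0 < Num.max (rho_ n) t by rewrite lt_max rho_n_gt0.
have t_le : t <= Num.max (rho_ n) t by rewrite le_max lexx orbT.
by rewrite mulrAC ler_pdivrMr//; apply: ler_wpM2l => //; exact: ltW.
Qed.

Let Cx n : C (x n).
Proof.
case: n => [|n]; first exact: alg_init x_alg.
by rewrite (alg_x x_alg); exact: metric_proj_in.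
Qed.

Let Qu n : Q (u n). Proof. by rewrite (alg_u x_alg); exact: metric_proj_in. Qed.

Let Cz n : C (z n). Proof. by rewrite (alg_z x_alg); exact: metric_proj_in. Qed.

(* When [A = 0] the upper bound on [mu] is void and [mu] is irrelevant: it may
   be replaced with [a]. *)
Let m n := if opnorm A == 0 then a else mu n.
Let M := if opnorm A == 0 then a else (opnorm A ^+ 2)^-1.

Let mu_m n v : mu n *: adjoint A v = m n *: adjoint A v.
Proof.
rewrite /m; case: eqP => // A0; suff -> : adjoint A v = 0 by rewrite !scaler0.
apply/eqP; rewrite -normr_le0.
by apply: le_trans (norm_adjoint_le Abounded v) _; rewrite A0 mul0r.
Qed.

Let m_ge n : a <= m n.
Proof. by rewrite /m; case: ifP. Qed.

Let m_ge0 n : 0 <= m n.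
Proof. exact: le_trans (ltW a_gt0) (m_ge n). Qed.

Let m_le n : m n <= M.
Proof.
rewrite /m /M; case: eqP => // /eqP A0; have := mu_le n.
by rewrite mul1e inver sqrf_eq0 (negbTE A0) lee_fin.
Qed.

Let m_adjoint n v : m n * `|adjoint A v| ^+ 2 <= `|v| ^+ 2.
Proof.
have := norm_adjoint_le Abounded v; have := m_le n; rewrite /m /M.
case: eqP => [-> _|/eqP A0 mM vA].
  by rewrite mul0r normr_le0 => /eqP ->; rewrite normr0 expr0n mulr0 sqr_ge0.
have A2 : 0 < opnorm A ^+ 2 by rewrite exprn_gt0// lt_def A0 opnorm_ge0.
apply: (@le_trans _ _ ((opnorm A ^+ 2)^-1 * (opnorm A * `|v|) ^+ 2)).
  apply: ler_pM => //; first exact: le_trans (ltW a_gt0) (mu_ge n).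
  by rewrite ler_sqr ?nnegrE ?mulr_ge0// ?opnorm_ge0.
by rewrite exprMn mulKf ?gt_eqF.
Qed.

(** Chains the step in [C], the subgradient step in [Q] and the gain from projecting [A (x n)] onto
    [Q]. Only feasibility of [s] is assumed, since [drift_bound] applies it outside [Omega]. *)
Let z_estimate n s : C s -> Q (A s) -> `|z n - s| ^+ 2 <= `|x n - s| ^+ 2 -
  m n * `|u n - A (x n)| ^+ 2 +
  m n * (2 * gamma n * '[w n, A s - u n] + beta n ^+ 2).
Proof.
move=> Cs QAs.
have hz : `|z n - s| ^+ 2 <= `|x n - s| ^+ 2 +
    m n * (`|y n - A s| ^+ 2 - `|A (x n) - A s| ^+ 2).
  rewrite (alg_z x_alg) mu_m; exact: split_step.
have hy : `|y n - A s| ^+ 2 <=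
    `|u n - A s| ^+ 2 + 2 * gamma n * '[w n, A s - u n] + beta n ^+ 2.
  rewrite (alg_y x_alg) -/(gamma n); apply: proj_subgradient_step => //.
    exact: stepsize_ge0.
  exact: stepsize_norm.
have hu : `|u n - A s| ^+ 2 <= `|A (x n) - A s| ^+ 2 - `|u n - A (x n)| ^+ 2.
  rewrite -[u n - A (x n)]opprB normrN (alg_u x_alg).
  exact: metric_proj_sqr_le.
have := ler_wpM2l (m_ge0 n) (le_trans hy (lerD (lerD hu (lexx _)) (lexx _))).
lra.
Qed.

Let x_estimate n s : C s -> `|x n.+1 - s| ^+ 2 <=
  `|z n - s| ^+ 2 + 2 * alpha n * '[g n, s - z n] + beta n ^+ 2.
Proof.
move=> Cs; rewrite (alg_x x_alg) -/(alpha n).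
apply: proj_subgradient_step => //; first exact: stepsize_ge0.
exact: stepsize_norm.
Qed.

(** The [F] step contributes errors weighted by [m n <= M], the [f] step by 1. *)
Let eta n := 2 * (M + 1) * (tau n * eps n) + (M + 1) * beta n ^+ 2.

Let M_ge0 : 0 <= M. Proof. exact: le_trans (m_ge0 0) (m_le 0). Qed.

Let cvg_eta : cvgn (series eta).
Proof.
have -> : eta = (2 * (M + 1)) *: (fun n => tau n * eps n) +
  (M + 1) *: (fun n => beta n ^+ 2) by [].
by apply: is_cvg_seriesD; exact: is_cvg_seriesZ.
Qed.

(** * Quasi-Fejer inequality at a solution [p] *)

Section SolutionPoint.
Variable p : H1.
Hypothesis Op : Omega p.

Let Fgap n := - F (u n) (A p).
Let fgap n := - f (z n) p.

Lemma Fgap_ge0 n : 0 <= Fgap n.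
Proof.
have [_ [_ EPF]] := Op; rewrite oppr_ge0.
by apply: (proj1 (EP_minty Qconvex F_assumptions _) EPF).2.
Qed.

Lemma fgap_ge0 n : 0 <= fgap n.
Proof.
have [_ [EPf _]] := Op; rewrite oppr_ge0.
by apply: (proj1 (EP_minty Cconvex f_assumptions _) EPf).2.
Qed.

Let gFgap_ge0 n : 0 <= gamma n * Fgap n.
Proof. by rewrite mulr_ge0 ?Fgap_ge0 ?stepsize_ge0. Qed.

Let afgap_ge0 n : 0 <= alpha n * fgap n.
Proof. by rewrite mulr_ge0 ?fgap_ge0 ?stepsize_ge0. Qed.

Let Cp : C p. Proof. by case: Op. Qed.
Let QAp : Q (A p). Proof. by case: Op => _ [_ []]. Qed.

Let inner_w n : '[w n, A p - u n] <= eps n - Fgap n.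
Proof.
have := alg_w x_alg n QAp; rewrite (eqa_diag F_assumptions (Qu n)) /Fgap; lra.
Qed.

Let inner_g n : '[g n, p - z n] <= eps n - fgap n.
Proof.
have := alg_g x_alg n Cp; rewrite (eqa_diag f_assumptions (Cz n)) /fgap; lra.
Qed.

(** The error is enlarged to the summable [tau n * e], while the gain keeps the actual step size
    [s]. *)
Let stepsize_inner n (s i e G : R) : 0 <= s -> s <= tau n -> 0 <= e ->
  i <= e - G -> s * i <= tau n * e - s * G.
Proof.
move=> s0 st e0 iG; have := ler_wpM2l s0 iG; have := ler_wpM2r e0 st; lra.
Qed.

Let Fterm n : m n * (2 * gamma n * '[w n, A p - u n] + beta n ^+ 2) <=
  2 * M * (tau n * eps n) + M * beta n ^+ 2 - 2 * a * (gamma n * Fgap n).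
Proof.
have := stepsize_inner (stepsize_ge0 n _) (stepsize_le_tau n `|w n|)
  (eps_ge0 n) (inner_w n); rewrite -/(gamma n) => /(ler_wpM2l (m_ge0 n)) h.
have te : 0 <= tau n * eps n by rewrite mulr_ge0.
have gF := gFgap_ge0 n.
have := ler_wpM2r te (m_le n); have := ler_wpM2r gF (m_ge n).
have := ler_wpM2r (sqr_ge0 (beta n)) (m_le n); lra.
Qed.

Lemma fejer_inequality n : `|x n.+1 - p| ^+ 2 +
  (a * `|u n - A (x n)| ^+ 2 +
   2 * (a * (gamma n * Fgap n) + alpha n * fgap n)) <= `|x n - p| ^+ 2 + eta n.
Proof.
have := x_estimate n Cp; have := z_estimate n Cp QAp; have := Fterm n.
have := stepsize_inner (stepsize_ge0 n _) (stepsize_le_tau n `|g n|)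
  (eps_ge0 n) (inner_g n); rewrite -/(alpha n).
have := ler_wpM2r (sqr_ge0 `|u n - A (x n)|) (m_ge n).
rewrite /eta; lra.
Qed.

Lemma z_fejer n : `|z n - p| ^+ 2 <= `|x n - p| ^+ 2 + eta n.
Proof.
have := z_estimate n Cp QAp; have := Fterm n.
have gF := mulr_ge0 (ltW a_gt0) (gFgap_ge0 n).
have : 0 <= m n * `|u n - A (x n)| ^+ 2 by rewrite mulr_ge0 ?sqr_ge0.
have te : 0 <= tau n * eps n by rewrite mulr_ge0.
have := sqr_ge0 (beta n); rewrite /eta; lra.
Qed.

Lemma fejer_cvg_series : cvgn (series (fun n => a * `|u n - A (x n)| ^+ 2 +
   2 * (a * (gamma n * Fgap n) + alpha n * fgap n))).
Proof.
apply: (quasi_fejer_series _ _ cvg_eta fejer_inequality) => n.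
  exact: sqr_ge0.
have := mulr_ge0 (ltW a_gt0) (sqr_ge0 `|u n - A (x n)|).
have := mulr_ge0 (ltW a_gt0) (gFgap_ge0 n); have := afgap_ge0 n; lra.
Qed.

End SolutionPoint.

Lemma solution_set_closed : closed Omega.
Proof.
have -> : Omega = C `&` (EP f C `&` A @^-1` EP F Q) by [].
apply: closedI => //; apply: closedI; first exact: EP_closed f_assumptions.
apply: preimage_closed; last exact: EP_closed F_assumptions.
by move=> v _; exact: bounded_linear_continuous.
Qed.

Lemma solution_set_convex : convex_set Omega.
Proof.
move=> p q t /set_mem[Cp [fp Fp]] /set_mem[Cq [fq Fq]].
apply/mem_set; split; last split.
- exact: (set_mem (Cconvex t (mem_set Cp) (mem_set Cq))).
- have := EP_convex Cconvex f_assumptions t (mem_set fp) (mem_set fq).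
  exact: set_mem.
- have := set_mem (EP_convex Qconvex F_assumptions t (mem_set Fp) (mem_set Fq)).
  by rewrite /conv /= linearD !linearZ.
Qed.

Let fejer p n : Omega p -> `|x n.+1 - p| ^+ 2 <= `|x n - p| ^+ 2 + eta n.
Proof.
move=> Op; have := fejer_inequality Op n.
have := mulr_ge0 (ltW a_gt0) (sqr_ge0 `|u n - A (x n)|).
have := mulr_ge0 (ltW a_gt0) (mulr_ge0 (stepsize_ge0 n `|w n|) (Fgap_ge0 Op n)).
have := mulr_ge0 (stepsize_ge0 n `|g n|) (fgap_ge0 Op n).
rewrite -/(gamma n) -/(alpha n); lra.
Qed.

Let x_bounded : exists B : R, forall n, `|x n| <= B.
Proof.
exact: (quasi_fejer_bounded Omega0 cvg_eta (fun p n Op => fejer n Op)).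
Qed.

Let u_bounded : exists B : R, forall n, `|u n| <= B.
Proof.
have [B xB] := x_bounded; have [p [_ [_ [QAp _]]]] := Omega0.
exists (opnorm A * (B + `|p|) + `|A p|) => n; rewrite -[u n](subrK (A p)).
apply: (le_trans (ler_normD _ _)); rewrite lerD2r (alg_u x_alg).
apply: (le_trans (metric_proj_le Q0 Qclosed Qconvex _ QAp)).
rewrite -linearB; apply: (le_trans (le_opnorm Abounded _)).
rewrite ler_wpM2l ?opnorm_ge0//.
by apply: (le_trans (ler_normB _ _)); rewrite lerD2r.
Qed.

Let z_bounded : exists B : R, forall n, `|z n| <= B.
Proof.
have [p Op] := Omega0.
have [B dB] := cvg_norm_bounded
  (quasi_fejer_dist_cvg cvg_eta (fun p n Op => fejer n Op) Op).
(* [eta] is bounded because it tends to 0. *)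
have [B' eB] := cvg_norm_bounded (cvgP _ (cvg_series_cvg_0 cvg_eta)).
exists (B + B' + 1 + `|p|) => n; rewrite -[z n](subrK p).
apply: (le_trans (ler_normD _ _)); rewrite lerD2r.
have := z_fejer Op n; have := dB n; have := eB n; rewrite !ler_norml.
move=> /andP[_ ?] /andP[_ ?] ?; nra.
Qed.

Let subgradients_bounded : exists2 L : R, rho <= L &
  forall n, `|w n| <= L /\ `|g n| <= L.
Proof.
have [Bu uB] := u_bounded; have [Bz zB] := z_bounded.
have [Lw wL] := bounded_subgradients F_assumptions Qu uB (alg_w x_alg).
have [Lg gL] := bounded_subgradients f_assumptions Cz zB (alg_g x_alg).
exists (Num.max rho (Num.max Lw Lg)); first by rewrite le_max lexx.
by move=> n; rewrite !le_max wL gL !orbT.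
Qed.

Let gap p n := - F (u n) (A p) - f (z n) p.

Let gap_ge0 p n : Omega p -> 0 <= gap p n.
Proof. by move=> Op; apply: addr_ge0; [exact: Fgap_ge0|exact: fgap_ge0]. Qed.

Let cvg_tau_gap p : Omega p -> cvgn (series (fun n => tau n * gap p n)).
Proof.
move=> Op; have [L rL wgL] := subgradients_bounded.
have L0 : 0 < L by exact: lt_le_trans rL.
(* [rho / L] compares [gamma] and [alpha] with [tau]; [Num.min a 1] is below the weights [a] and 1
   of the two gaps. *)
pose k := Num.min a 1 * (rho / L).
have min0 : 0 < Num.min a 1 by rewrite lt_min a_gt0 ltr01.
have k0 : 0 < k by rewrite mulr_gt0// divr_gt0.
have mina : Num.min a 1 <= a by rewrite ge_min lexx.
have min1 : Num.min a 1 <= 1 by rewrite ge_min lexx orbT.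
pose c n := a * `|u n - A (x n)| ^+ 2 +
  2 * (a * (gamma n * - F (u n) (A p)) + alpha n * - f (z n) p).
have kc n : k * (tau n * gap p n) <= c n.
  have [wL gL] := wgL n; have Fg := Fgap_ge0 Op n; have fg := fgap_ge0 Op n.
  have := stepsize_ge rho_gt0 (rho_ge n) rL wL (ltW (beta_gt0 n)).
  rewrite -/(gamma n) -/(tau n) => /(ler_wpM2r Fg)/(ler_wpM2l (ltW min0)).
  have := stepsize_ge rho_gt0 (rho_ge n) rL gL (ltW (beta_gt0 n)).
  rewrite -/(alpha n) -/(tau n) => /(ler_wpM2r fg)/(ler_wpM2l (ltW min0)).
  have gF : 0 <= gamma n * - F (u n) (A p) by rewrite mulr_ge0 ?stepsize_ge0.
  have af : 0 <= alpha n * - f (z n) p by rewrite mulr_ge0 ?stepsize_ge0.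
  have := ler_wpM2r gF mina; have := ler_wpM2r af min1.
  have := mulr_ge0 (ltW a_gt0) (sqr_ge0 `|u n - A (x n)|).
  have := mulr_ge0 (ltW a_gt0) gF.
  rewrite /c /k /gap; lra.
have tg0 n : 0 <= tau n * gap p n by rewrite mulr_ge0 ?gap_ge0.
apply: (@series_le_cvg _ _ (fun n => k^-1 * c n)) => // [n|n|].
- rewrite mulr_ge0 ?invr_ge0 ?(ltW k0)// (le_trans _ (kc n))//.
  by rewrite mulr_ge0 ?(ltW k0).
- by rewrite ler_pdivlMl.
- have -> : (fun n => k^-1 * c n) = k^-1 *: c by [].
  by apply: is_cvg_seriesZ; exact: fejer_cvg_series Op.
Qed.

Let u_Ax_cvg0 : `|u n - A (x n)| @[n --> \oo] --> (0 : R).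
Proof.
have [p Op] := Omega0; apply/cvgr0Pnorm_le => e e0.
have ae : 0 < a * e ^+ 2 by rewrite mulr_gt0// exprn_gt0.
move/cvgr0Pnorm_le : (cvg_series_cvg_0 (fejer_cvg_series Op)) => /(_ _ ae).
apply: filterS => n; rewrite ler_norml normr_id => /andP[_ h].
rewrite -ler_sqr ?nnegrE ?(ltW e0)// -(ler_pM2l a_gt0).
have := mulr_ge0 (ltW a_gt0) (mulr_ge0 (stepsize_ge0 n `|w n|) (Fgap_ge0 Op n)).
have := mulr_ge0 (stepsize_ge0 n `|g n|) (fgap_ge0 Op n).
move: h; rewrite -/(gamma n) -/(alpha n); lra.
Qed.

Let beta_cvg0 : beta n @[n --> \oo] --> (0 : R).
Proof.
apply/cvgr0Pnorm_le => e e0.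
have e2 : 0 < e ^+ 2 by rewrite exprn_gt0.
move/cvgr0Pnorm_le : (cvg_series_cvg_0 cvg_beta2) => /(_ _ e2).
apply: filterS => n; rewrite normrX => h.
by rewrite -ler_sqr ?nnegrE ?(ltW e0).
Qed.

Let z_x_cvg0 : `|z n - x n| @[n --> \oo] --> (0 : R).
Proof.
have le_step n : `|z n - x n| <= (M + 1) * (beta n + `|u n - A (x n)|).
  have y_Ax : `|y n - A (x n)| <= beta n + `|u n - A (x n)|.
    rewrite -[y n](subrK (u n)) -addrA; apply: (le_trans (ler_normD _ _)).
    rewrite lerD2r (alg_y x_alg).
    apply: (le_trans (metric_proj_le Q0 Qclosed Qconvex _ (Qu n))).
    rewrite addrAC subrr add0r normrN normrZ ger0_norm.
      exact: stepsize_norm.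
    exact: stepsize_ge0.
  have z_x : `|z n - x n| <= `|m n *: adjoint A (y n - A (x n))|.
    rewrite (alg_z x_alg) mu_m.
    apply: (le_trans (metric_proj_le C0 Cclosed Cconvex _ (Cx n))).
    by rewrite addrAC subrr add0r.
  apply: (le_trans z_x); apply: (@le_trans _ _ ((M + 1) * `|y n - A (x n)|)).
    (* In squares the bound is [m^2 |A* v|^2 <= M |v|^2 <= (M + 1)^2 |v|^2], so [M + 1] replaces a
       square root. *)
    have M1 : 0 <= (M + 1) * `|y n - A (x n)| by rewrite mulr_ge0 ?addr_ge0.
    rewrite -ler_sqr ?nnegrE// normrZ exprMn ger0_norm// expr2 -mulrA.
    apply: (@le_trans _ _ (M * `|y n - A (x n)| ^+ 2)).
      apply: ler_pM; [exact: m_ge0| |exact: m_le|exact: m_adjoint].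
      by rewrite mulr_ge0 ?sqr_ge0.
    rewrite exprMn ler_wpM2r ?sqr_ge0//; have := M_ge0; nra.
  by rewrite ler_wpM2l// addr_ge0.
apply: (@squeeze_cvgr _ _ _ _ (cst 0)
  (fun n => (M + 1) * (beta n + `|u n - A (x n)|))).
- by apply: nearW => n; rewrite normr_ge0 le_step.
- exact: cvg_cst.
- rewrite -[X in _ --> X](mulr0 (M + 1)); apply: cvgM; first exact: cvg_cst.
  by rewrite -[X in _ --> X](addr0 0); exact: (cvgD beta_cvg0 u_Ax_cvg0).
Qed.

(** * Weak cluster points of the iterates *)

Section ClusterPoints.
Variables (G : set_system nat) (q : H1).
Hypotheses (GP : ProperFilter G) (ooG : \oo `<=` G) (xq : weak_limit G x q).

Let cvg_cluster (r : nat -> R) (l : R) :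
  r n @[n --> \oo] --> l -> r n @[n --> G] --> l.
Proof. by move=> rl W /rl; exact: ooG. Qed.

Let z_cluster : weak_limit G z q.
Proof. exact: weak_limit_cvg0 xq (cvg_cluster z_x_cvg0). Qed.

Let u_cluster : weak_limit G u (A q).
Proof.
apply: (weak_limit_cvg0 _ (cvg_cluster u_Ax_cvg0)) => v.
rewrite adjointP//.
have -> : (fun n => '[A (x n), v]) = (fun n => '[x n, adjoint A v]).
  by apply/funext => n; rewrite adjointP.
exact: xq.
Qed.

Lemma cluster_feasible : C q /\ Q (A q).
Proof.
split; first exact: weak_limit_closed_convex C0 Cclosed Cconvex Cx xq.
exact: weak_limit_closed_convex Q0 Qclosed Qconvex Qu u_cluster.
Qed.

Lemma cluster_solution p : Omega p ->
  gap p n @[n --> G] --> (0 : R) -> Omega q.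
Proof.
move=> Op gap0; have [Cq QAq] := cluster_feasible.
have [_ [fp Fp]] := Op.
(* The two gaps are nonnegative, so each bifunction value is squeezed between [- gap p n] and 0. *)
have null (r : nat -> R) : (forall n, r n <= 0) ->
    (forall n, - r n <= gap p n) -> r n @[n --> G] --> (0 : R).
  move=> r0 rgap; apply: (@squeeze_cvgr _ _ _ _ (fun n => - gap p n) (cst 0)).
  - by apply: nearW => n; rewrite r0 andbT lerNl rgap.
  - by rewrite -oppr0; exact: cvgN.
  - exact: cvg_cst.
split=> //; split.
  apply: (EP_weak_limit Cconvex f_assumptions GP fp Cq Cz z_cluster).
  apply: null => n; first by rewrite -oppr_ge0; exact: fgap_ge0.
  by rewrite lerDr; exact: Fgap_ge0.
apply: (EP_weak_limit Qconvex F_assumptions GP Fp QAq Qu u_cluster).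
apply: null => n; first by rewrite -oppr_ge0; exact: Fgap_ge0.
by rewrite lerDl; exact: fgap_ge0.
Qed.

End ClusterPoints.

Let xd := limn (fun n => metric_proj Omega (x n)).

Let proj_cvg : metric_proj Omega (x n) @[n --> \oo] --> xd.
Proof.
exact: (quasi_fejer_proj_cvg Omega0 solution_set_closed solution_set_convex
  cvg_eta (fun p n Op => fejer n Op)).
Qed.

Let Oxd : Omega xd.
Proof.
apply: (closed_cvg _ solution_set_closed _ _ proj_cvg).
apply: nearW => n.
exact: metric_proj_in Omega0 solution_set_closed solution_set_convex _.
Qed.

Let solution_cluster_unique (G : set_system nat) q : ProperFilter G ->
  \oo `<=` G -> weak_limit G x q -> Omega q -> q = xd.
Proof.
move=> GP ooG xq Oq; have [B xB] := x_bounded.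
have [B' pB] := cvg_norm_bounded (cvgP _ proj_cvg).
have pG : metric_proj Omega (x n) @[n --> G] --> xd.
  by move=> W /proj_cvg; exact: ooG.
apply: (weak_limit_obtuse (B := B + B') xq pG) => n.
  by apply: (le_trans (ler_normB _ _)); rewrite lerD.
exact: metric_proj_inner_le0 Omega0 solution_set_closed
  solution_set_convex _ _ Oq.
Qed.

(** At a feasible [q] the inner products have no known sign, but Cauchy-Schwarz and the bounds on
    iterates and subgradients make their contribution [O(tau n)]. *)
Let drift_bound q : C q -> Q (A q) -> exists2 K : R, 0 <= K &
  forall n, `|x n.+1 - q| ^+ 2 <=
    `|x n - q| ^+ 2 + (K * tau n + (M + 1) * beta n ^+ 2).
Proof.
move=> Cq QAq; have [L rL wgL] := subgradients_bounded.
have [Bu uB] := u_bounded; have [Bz zB] := z_bounded.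
have L0 : 0 <= L by rewrite (le_trans (ltW rho_gt0)).
have Bu0 : 0 <= Bu by exact: le_trans (normr_ge0 _) (uB 0%N).
have Bz0 : 0 <= Bz by exact: le_trans (normr_ge0 _) (zB 0%N).
pose Kw := L * (`|A q| + Bu); pose Kg := L * (`|q| + Bz).
have Kw0 : 0 <= Kw by rewrite mulr_ge0 ?addr_ge0.
have Kg0 : 0 <= Kg by rewrite mulr_ge0 ?addr_ge0.
exists (2 * M * Kw + 2 * Kg) => [|n].
  by have := mulr_ge0 M_ge0 Kw0; lra.
have [wL gL] := wgL n.
have step (s i k : R) : 0 <= s -> s <= tau n -> 0 <= k -> i <= k ->
    s * i <= tau n * k.
  by move=> s0 st k0 ik; apply: (le_trans (ler_wpM2l s0 ik)); rewrite ler_wpM2r.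
have iw : '[w n, A q - u n] <= Kw.
  apply: (le_trans (inner_le_norm _ _)); apply: ler_pM => //.
  by apply: (le_trans (ler_normB _ _)); rewrite lerD2l.
have ig : '[g n, q - z n] <= Kg.
  apply: (le_trans (inner_le_norm _ _)); apply: ler_pM => //.
  by apply: (le_trans (ler_normB _ _)); rewrite lerD2l.
have := step _ _ _ (stepsize_ge0 n `|w n|) (stepsize_le_tau n _) Kw0 iw.
rewrite -/(gamma n) => /(ler_wpM2l (m_ge0 n)) hw.
have hg := step _ _ _ (stepsize_ge0 n `|g n|) (stepsize_le_tau n _) Kg0 ig.
rewrite -/(alpha n) in hg.
have := ler_wpM2r (mulr_ge0 (tau_ge0 n) Kw0) (m_le n).
have := ler_wpM2r (sqr_ge0 (beta n)) (m_le n).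
have := mulr_ge0 (m_ge0 n) (sqr_ge0 `|u n - A (x n)|).
have := x_estimate n Cq; have := z_estimate n Cq QAq; lra.
Qed.

Let cluster_unique (G : set_system nat) q : ProperFilter G ->
  \oo `<=` G -> weak_limit G x q -> q = xd.
Proof.
move=> GP ooG xq; apply/eqP/negPn/negP => qxd.
pose D := `|q - xd| ^+ 2 / 2.
have D0 : 0 < D by rewrite divr_gt0// exprn_gt0// normr_gt0 subr_eq0.
(* [phi] is affine in [x n], hence weakly continuous: it tends to [2 |q - xd|^2 = 4 D] along [G],
   and to 0 along any filter with weak limit [xd]. *)
pose phi n := `|x n - xd| ^+ 2 - `|x n - q| ^+ 2 + 2 * D.
have phiE n : phi n = 2 * '[x n - xd, q - xd].
  rewrite /phi /D; have -> : x n - q = (x n - xd) - (q - xd).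
    by rewrite opprB addrA subrK.
  by rewrite (sqr_normB (x n - xd)); field.
have phi_cvg (G' : set_system nat) q' : ProperFilter G' -> weak_limit G' x q' ->
    phi n @[n --> G'] --> 2 * '[q' - xd, q - xd].
  move=> G'P xq'.
  have -> : phi = (fun n => 2 * ('[x n, q - xd] - '[xd, q - xd])).
    by apply/funext => n; rewrite phiE innerDl innerNl.
  rewrite innerDl innerNl; apply: cvgM; first exact: cvg_cst.
  by apply: cvgB; [exact: xq'|exact: cvg_cst].
have [Cq QAq] := cluster_feasible GP ooG xq.
have [K K0 drift] := drift_bound Cq QAq.
(* otherwise a cluster point along which the gap vanishes would be a solution
   different from [xd] *)
have [k gap_large] : exists k, forall n, (k <= n)%N -> D <= phi n ->
    k.+1%:R^-1 <= gap xd n.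
  apply: contrapT => no_k; have [B xB] := x_bounded.
  pose P k := [set n | D <= phi n /\ gap xd n <= k.+1%:R^-1].
  have [j k n jk [Dn gn]|k|G' [G'P ooG' G'Pk [q' xq']]] :=
      subsequence_weak_limit (P := P) xB.
  - split=> //; apply: (le_trans gn).
    by rewrite lef_pV2 ?posrE// ler_nat.
  - apply: contrapT => no_n; apply: no_k; exists k => n kn Dn.
    rewrite leNgt; apply/negP => gn; apply: no_n; exists n; split=> //.
    by split=> //; exact: ltW.
  have gap0 : gap xd n @[n --> G'] --> (0 : R).
    apply/cvgr0Pnorm_le => e e0.
    have [N _ small] := near_infty_natSinv_lt (PosNum e0).
    apply: filterS (G'Pk N) => n [_ gn]; rewrite ger0_norm ?gap_ge0//.
    by apply: (le_trans gn); apply/ltW/(small N) => /=.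
  have q'xd : q' = xd.
    apply: (solution_cluster_unique G'P ooG' xq').
    exact: (cluster_solution G'P ooG' xq' Oxd gap0).
  have : D <= 2 * '[q' - xd, q - xd].
    apply: (cvgr_to_ge (phi_cvg _ _ G'P xq')).
    by apply: filterS (G'Pk 0%N) => n [].
  by rewrite q'xd subrr inner0l mulr0 leNgt D0.
have cvg_dist := quasi_fejer_dist_cvg cvg_eta (fun p n Op => fejer n Op) Oxd.
have cvg_beta : cvgn (series (fun n => (M + 1) * beta n ^+ 2)).
  have -> : (fun n => (M + 1) * beta n ^+ 2) =
    (M + 1) *: (fun n => beta n ^+ 2) by [].
  exact: is_cvg_seriesZ.
(* Here [b] is the convergent [|x n - xd|^2], and [drift] limits the growth of [|x n - q|^2]. The
   outcome [phi < 3 D] contradicts the limit [4 D] along [G]. *)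
have [//||N smallN] := eventually_small_of_drift K0 D0 (_ : 0 < k.+1%:R^-1)
  tau_ge0 (fun n => gap_ge0 n Oxd) cvg_dist cvg_beta (cvg_tau_gap Oxd) dvg_tau
  _ gap_large.
- by move=> n; have := drift n; rewrite /phi; lra.
have : 2 * '[q - xd, q - xd] <= 3 * D.
  apply: (cvgr_to_le (phi_cvg _ _ GP xq)); apply: ooG; exists N => // n Nn.
  exact/ltW/smallN.
rewrite inner_norm; move: D0; rewrite /D; lra.
Qed.

Lemma projection_algorithm_converges : exists xd : H1,
  [/\ Omega xd, weak_cvg x xd & metric_proj Omega (x n) @[n --> \oo] --> xd].
Proof.
exists xd; split=> //; apply/weak_cvgP => v W nW; apply: contrapT => notW.
have [B xB] := x_bounded.
(* If ['[x n, v]] left [W] infinitely often, those indices would carry a weak cluster point, which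
   must be [xd]. *)
pose P (_ : nat) := [set n | ~ W '[x n, v]].
have [//|k|G [GP ooG /(_ 0%N) GnW [q xq]]] :=
    subsequence_weak_limit (P := P) xB.
  apply: contrapT => no_n; apply: notW; exists k => // n kn.
  by apply: contrapT => nWn; apply: no_n; exists n.
move: nW; rewrite -(cluster_unique GP ooG xq) => nW.
have GW : G ((fun n => '[x n, v]) @^-1` W) by exact: xq nW.
by have [n []] := filter_ex (filterI GnW GW).
Qed.

End Convergence.

Theorem theorem3p4 (R : realType) (H1 H2 : hilbertType R)
    (C : set H1) (Q : set H2) (A : {linear H1 -> H2})
    (f : H1 -> H1 -> R) (F : H2 -> H2 -> R)
    (rho_ beta eps mu : nat -> R) (rho a : R)
    (C0 : C !=set0) (Cclosed : closed C) (Cconvex : convex_set C)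
    (Q0 : Q !=set0) (Qclosed : closed Q) (Qconvex : convex_set Q)
    (Abounded : bounded_fun_norm A)
    (rho_gt0 : 0 < rho) (a_gt0 : 0 < a)
    (rho_ge : forall n, rho <= rho_ n)
    (eps_ge0 : forall n, 0 <= eps n)
    (beta_gt0 : forall n, 0 < beta n)
    (mu_ge : forall n, a <= mu n)
    (* division in \bar R, with 1 / 0 = +oo: A = 0 is not excluded *)
    (mu_le : forall n, ((mu n)%:E <= 1 / (opnorm A ^+ 2)%:E)%E)
    (sum_beta_rho : (\sum_(1 <= n <oo) (beta n / rho_ n)%:E = +oo)%E)
    (sum_beta_eps_rho :
      (\sum_(1 <= n <oo) (beta n * eps n / rho_ n)%:E < +oo)%E)
    (sum_beta2 : (\sum_(1 <= n <oo) (beta n ^+ 2)%:E < +oo)%E)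
    (f_assumptions : equilibrium_assumptions eps C f)
    (F_assumptions : equilibrium_assumptions eps Q F)
    (Omega0 : solution_set C Q A f F !=set0)
    (x z g : nat -> H1) (u w y : nat -> H2)
    (x_alg : projection_algorithm C Q A f F rho_ beta eps mu x z g u w y) :
  exists xd : H1,
    [/\ solution_set C Q A f F xd,
        weak_cvg x xd &
        metric_proj (solution_set C Q A f F) (x n) @[n --> \oo] --> xd].
Proof.
have rho_n0 n : 0 < rho_ n by exact: lt_le_trans (rho_ge n).
apply: (projection_algorithm_converges C0 Cclosed Cconvex Q0 Qclosed Qconvex
  Abounded rho_gt0 a_gt0 rho_ge eps_ge0 beta_gt0 mu_ge mu_le f_assumptions
  F_assumptions x_alg Omega0).
(* The three extended-real sums become divergence or convergence of [series]. *)
- apply: not_cvg_series_nneseries sum_beta_rho => n.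
  by rewrite divr_ge0 ?ltW.
- have -> : (fun n => beta n / rho_ n * eps n) =
    (fun n => beta n * eps n / rho_ n).
    by apply/funext => n; rewrite mulrAC.
  apply: cvg_series_nneseries sum_beta_eps_rho => n.
  by rewrite divr_ge0 ?mulr_ge0 ?eps_ge0 ?ltW.
- by apply: cvg_series_nneseries sum_beta2 => n; exact: sqr_ge0.
Qed.
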